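(* Let $f$ be a decomposable CN function with CN form $f=[g:g_1,\dots,g_r]$ and decomposition $((\bm x_1,\bm y_1),\dots,(\bm x_p,\bm y_p))$ of $(\bm x,\bm y)$, and let $(\bm x^*,\bm y^* )\in X(f)$. For each $j=1,\dots,p$ define $$K_{cj}(\bm x_j^*,\bm y_j^* )=\{(\bm x_j,\bm y_j)\in\mathbb{R}^{p_j}\times\mathbb{R}^{q_j}:\ \nabla_jg(\bm x^*,\bm y^* )^\top(\bm x_j-\bm x_j^*,\bm y_j-\bm y_j^* )<0\}.$$ If $X(\bm g_j)\cap K_{cj}(\bm x_j^*,\bm y_j^* )=\emptyset$ holds for each $j=1,\dots,p$, then $(\bm x^*,\bm y^* )$ is an optimal solution to (CNP) and $\bm x^*$ is an optimal solution to (CNO).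
   Context: Let $f:\mathbb{R}^n\to\mathbb{R}$ be nonconvex and let $g,g_1,\dots,g_r:\mathbb{R}^n\times\mathbb{R}^m\to\mathbb{R}$ ($r\ge1$) be convex and twice differentiable. Put $X(\bm g)=\{(\bm x,\bm y): g_i(\bm x,\bm y)=0,\ i=1,\dots,r\}$. $f$ is a CN (convertible nonconvex) function with CN form $f=[g:g_1,\dots,g_r]$ if for each $\bm x\in\mathbb{R}^n$ there is $\bm y\in\mathbb{R}^m$ with $(\bm x,\bm y)\in X(\bm g)$ and $f(\bm x)=g(\bm x,\bm y)=\min_{(\bm x,\bm y')\in X(\bm g)}g(\bm x,\bm y')$. $X(f)=\{(\bm x,\bm y)\in X(\bm g): f(\bm x)=g(\bm x,\bm y)\}$. (CNO): $\min f(\bm x)$ s.t. $\bm x\in\mathbb{R}^n$. (CNP): $\min g(\bm x,\bm y)$ s.t. $g_i(\bm x,\bm y)=0$, $i=1,\dots,r$. ''Optimal solution'' means global minimizer. Decomposition: the variables of $(\bm x,\bm y)\in\mathbb{R}^n\times\mathbb{R}^m$ are rearranged into $p$ blocks ($2\le p\le\min\{n,m\}$) $((\bm x_1,\bm y_1),\dots,(\bm x_p,\bm y_p))$, $\bm x_j\in\mathbb{R}^{p_j}$, $\bm y_j\in\mathbb{R}^{q_j}$, $\sum_jp_j=n$, $\sum_jq_j=m$, with no variable common to two blocks. $f$ is decomposable if each of $g_1,\dots,g_r$ depends on the variables of one block only, so that the constraints can be written $\bm g(\bm x,\bm y)=(\bm g_1(\bm x_1,\bm y_1),\dots,\bm g_p(\bm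 x_p,\bm y_p))=0$. $\nabla_j$ denotes the gradient with respect to the block $(\bm x_j,\bm y_j)$, the other blocks being fixed. $X(\bm g_j)$ is the set of $(\bm x_j,\bm y_j)\in\mathbb{R}^{p_j}\times\mathbb{R}^{q_j}$ for which all constraints $g_i=0$ hold when the other blocks are fixed at the values of a point of $X(\bm g)$; in the decomposable case this is $\{(\bm x_j,\bm y_j):\bm g_j(\bm x_j,\bm y_j)=0\}$. *)

(* Defs.v *)
From HB Require Import structures.
From mathcomp Require Import all_boot all_order all_algebra.
From mathcomp Require Import all_classical all_reals all_analysis.
Set Implicit Arguments.
Unset Strict Implicit.
Unset Printing Implicit Defensive.
Import Order.TTheory GRing.Theory Num.Theory.
Import numFieldNormedType.Exports.
Local Open Scope classical_set_scope.
Local Open Scope ring_scope.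

Section Calculus.
Context {R : realType} {a b : nat}.
Implicit Types (h : 'rV[R]_a * 'rV[R]_b -> R) (z u v : 'rV[R]_a * 'rV[R]_b).

(* The vector of partial derivatives, split like the argument. *)
Definition grad h z : 'rV[R]_a * 'rV[R]_b :=
  (\row_i 'D_(delta_mx 0 i, 0) (h : _ -> R^o) z,
   \row_k 'D_(0, delta_mx 0 k) (h : _ -> R^o) z).

Definition dot u v : R :=
  \sum_i u.1 0 i * v.1 0 i + \sum_k u.2 0 k * v.2 0 k.

(* The space of differentials carries no norm in the library, so the second
   derivative is taken as the derivative of the gradient. *)
Definition twice_differentiable h : Prop :=
  (forall z, differentiable (h : _ -> R^o) z) /\
  (forall z, differentiable (grad h) z).

End Calculus.

Definition global_min (R : realType) (T : Type) (S : set T) (h : T -> R)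
  (s : T) : Prop := S s /\ forall s', S s' -> h s <= h s'.

Section ConvertibleNonconvex.
Context {R : realType} {n m r : nat}.
Implicit Types (f : 'rV[R]_n -> R) (g : 'rV[R]_n * 'rV[R]_m -> R)
  (gs : 'I_r -> 'rV[R]_n * 'rV[R]_m -> R).

Definition feasible gs : set ('rV[R]_n * 'rV[R]_m) :=
  [set z | forall i, gs i z = 0].

Record CN_form f g gs : Prop := {
  CN_r_ge1 : (1 <= r)%N;
  CN_nonconvex : ~ convex_function [set: 'rV[R]_n] f;
  CN_obj_convex : convex_function [set: 'rV[R]_n * 'rV[R]_m] g;
  CN_obj_diff : twice_differentiable g;
  CN_con_convex : forall i,
    convex_function [set: 'rV[R]_n * 'rV[R]_m] (gs i);
  CN_con_diff : forall i, twice_differentiable (gs i);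
  CN_min : forall x, exists y, f x = g (x, y) /\
    global_min [set y' | feasible gs (x, y')] (fun y' => g (x, y')) y
}.

Definition CN_points f g gs : set ('rV[R]_n * 'rV[R]_m) :=
  [set z | feasible gs z /\ f z.1 = g z].

Definition CNP_optimal g gs (z : 'rV[R]_n * 'rV[R]_m) : Prop :=
  global_min (feasible gs) g z.

Definition CNO_optimal f (x : 'rV[R]_n) : Prop :=
  global_min [set: 'rV[R]_n] f x.

End ConvertibleNonconvex.

(* A rearrangement of the variables into p blocks is given by the block to which
   each variable belongs; blocks are then disjoint and their sizes add up to
   n and m automatically. *)
Record decomposition (n m p : nat) := Decomposition {
  xblock : 'I_n -> 'I_p;
  yblock : 'I_m -> 'I_p
}.

Section RowBlocks.
Context {R : realType} {n p : nat}.
Variables (c : 'I_n -> 'I_p) (j : 'I_p).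

Definition bsize : nat := #|[pred k | c k == j]|.

Definition bvar (l : 'I_bsize) : 'I_n := enum_val l.

Definition subrow (x : 'rV[R]_n) : 'rV[R]_bsize := \row_l x 0 (bvar l).

(* x with the entries of block j replaced by those of w. *)
Definition patchrow (x : 'rV[R]_n) (w : 'rV[R]_bsize) : 'rV[R]_n :=
  \row_k if [pick l | bvar l == k] is Some l then w 0 l else x 0 k.

End RowBlocks.

Section Blocks.
Context {R : realType} {n m p : nat}.
Variables (d : decomposition n m p) (j : 'I_p).

Definition bspace : Type :=
  ('rV[R]_(bsize (xblock d) j) * 'rV[R]_(bsize (yblock d) j))%type.

Definition block (z : 'rV[R]_n * 'rV[R]_m) : bspace :=
  (subrow (xblock d) j z.1, subrow (yblock d) j z.2).

Definition patch (z : 'rV[R]_n * 'rV[R]_m) (w : bspace) :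
    'rV[R]_n * 'rV[R]_m :=
  (patchrow z.1 w.1, patchrow z.2 w.2).

Definition block_grad (g : 'rV[R]_n * 'rV[R]_m -> R)
    (z : 'rV[R]_n * 'rV[R]_m) : bspace :=
  grad (fun w => g (patch z w)) (block z).

(* The set X(g_j), the blocks other than j being fixed as in z. *)
Definition block_feasible (r : nat) (gs : 'I_r -> 'rV[R]_n * 'rV[R]_m -> R)
    (z : 'rV[R]_n * 'rV[R]_m) : set bspace :=
  [set w | feasible gs (patch z w)].

(* The set K_cj at the j-th block of z. *)
Definition descent_cone (g : 'rV[R]_n * 'rV[R]_m -> R)
    (z : 'rV[R]_n * 'rV[R]_m) : set bspace :=
  [set w | dot (block_grad g z)
             (w.1 - (block z).1, w.2 - (block z).2) < 0].

End Blocks.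

Arguments block_grad {R n m p} d j g z.
Arguments block_feasible {R n m p} d j {r} gs z.
Arguments descent_cone {R n m p} d j g z.

Definition decomposable (R : realType) (n m p r : nat)
    (d : decomposition n m p) (gs : 'I_r -> 'rV[R]_n * 'rV[R]_m -> R) : Prop :=
  forall i, exists j, forall z z' : 'rV[R]_n * 'rV[R]_m,
    block d j z = block d j z' -> gs i z = gs i z'.

(* Main.v *)
Require Import Defs.
From HB Require Import structures.
From mathcomp Require Import all_boot all_order all_algebra.
From mathcomp Require Import all_classical all_reals all_analysis.
From mathcomp Require Import ring.
Set Implicit Arguments.
Unset Strict Implicit.
Unset Printing Implicit Defensive.
Import Order.TTheory GRing.Theory Num.Theory.
Import numFieldNormedType.Exports.
Local Open Scope classical_set_scope.
Local Open Scope ring_scope.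

(** The hypothesis says that, at the given point s, the linearisation of g along
    block j is nonnegative on X(g_j), one block at a time.  Global optimality
    follows because both sides of this condition split over the blocks.

    On the side of the constraints, each g_i reads a single block.  Hence if s and
    z are both feasible, so is the point obtained from s by replacing its j-th
    block with that of z: every constraint is evaluated either on a block of s or
    on a block of z ([decomposable_patch_feasible]).  The j-th block of z thus lies
    in X(g_j), outside K_cj, and the j-th linearisation is nonnegative at it.

    On the side of the objective, the blocks partition the variables and a partial
    derivative of g along block j is a partial derivative of g, so the sum over j
    of the block linearisations is the full pairing of the gradient with z - s
    ([sum_block_grad]); as g is differentiable, this is the directional derivative
    of g at s towards z ([derive_partials]).  It is therefore nonnegative, and the
    gradient inequality for convex functions ([convex_derive_le]) bounds
    g z - g s below by it.  So s minimises g over the feasible set.  The minimality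
    of f xs among all the values of f follows, since every value f x is attained
    by g at some feasible (x, y). *)

(** The graph of a convex function lies above its tangents: for 0 < t <= 1 the
    difference quotient of step t towards b is at most h b - h a, and the
    directional derivative is the limit of these quotients from the right. *)
Lemma convex_derive_le (R : realType) (V : normedModType R) (h : V -> R)
    (a b : V) :
  convex_function [set: V] h -> derivable (h : V -> R^o) a (b - a) ->
  'D_(b - a) (h : V -> R^o) a <= h b - h a.
Proof.
move=> hconv hder; rewrite /derive cvg_at_rightE//; apply: limr_le.
  move/cvg_ex: hder => [l hl]; apply/cvg_ex; exists l.
  exact: cvg_dnbhs_at_right.
near=> t.
have t_gt0 : 0 < t by [].
have t_le1 : t <= 1 by near: t; apply: nbhs_right_le.
have := hconv (Itv01 (ltW t_gt0) t_le1) b a.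
rewrite !in_setT => /(_ isT isT); rewrite /conv /= => hle.
rewrite [_ *: _]mulrC ler_pdivrMr//.
have -> : t *: (b - a) + a = t *: b + (1 - t) *: a.
  by rewrite scalerBr scalerBl scale1r addrA addrAC.
rewrite lerBlDr; apply: le_trans hle _.
suff -> : (h b - h a) * t + h a = t * h b + (1 - t) * h a by [].
by ring.
Unshelve. all: by end_near. Qed.

Lemma bvar_block (n p : nat) (c : 'I_n -> 'I_p) (j : 'I_p)
    (l : 'I_(bsize c j)) : c (bvar l) = j.
Proof. by have := enum_valP l; rewrite inE => /eqP. Qed.

Section Rows.
Context {R : realType} {n p : nat} (c : 'I_n -> 'I_p) (j : 'I_p).
Implicit Types (x : 'rV[R]_n) (w v : 'rV[R]_(bsize c j)).

Lemma patchrow_bvar x w l : patchrow x w 0 (bvar l) = w 0 l.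
Proof.
rewrite mxE; case: pickP => [l' /eqP/enum_val_inj -> //|/(_ l)].
by rewrite eqxx.
Qed.

Lemma patchrow_out x w k : c k != j -> patchrow x w 0 k = x 0 k.
Proof.
move=> ck; rewrite mxE; case: pickP => // l /eqP lk.
by rewrite -lk bvar_block eqxx in ck.
Qed.

(** Every entry of a row is either one of the variables of block j or outside of
    it; this lets identities about patched rows be checked entry by entry without
    unfolding the choice made by [patchrow]. *)
Variant block_spec k : Prop :=
  | InBlock (l : 'I_(bsize c j)) of k = bvar l & c k = j
  | OutBlock of c k != j.

Lemma blockP k : block_spec k.
Proof.
have [ck|ck] := eqVneq (c k) j; last exact: OutBlock.
have kj : k \in [pred k | c k == j] by rewrite inE ck.
by apply: (@InBlock k (enum_rank_in kj k)) => //; rewrite /bvar enum_rankK_in.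
Qed.

Lemma subrow_patchrow x w : subrow c j (patchrow x w) = w.
Proof. by apply/rowP => l; rewrite mxE patchrow_bvar. Qed.

Lemma subrow_patchrow_neq j' x w :
  j' != j -> subrow c j' (patchrow x w) = subrow c j' x.
Proof.
move=> jj'; apply/rowP => l; rewrite mxE [RHS]mxE.
by apply: patchrow_out; rewrite bvar_block.
Qed.

(** Patching is affine in the new block: the points obtained by moving in block j
    only form a line whose direction is that of the block, extended by zero. *)
Lemma patchrow_line x v (t : R) :
  patchrow x (t *: v + subrow c j x) = t *: patchrow 0 v + x.
Proof.
apply/rowP => k; rewrite [RHS]mxE [X in _ = X + _]mxE.
case: (blockP k) => [l -> _|ck]; first by rewrite !patchrow_bvar !mxE.
by rewrite !patchrow_out// mxE mulr0 add0r.
Qed.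

Lemma patchrow_delta (l : 'I_(bsize c j)) :
  patchrow 0 (delta_mx 0 l) = delta_mx 0 (bvar l) :> 'rV[R]_n.
Proof.
apply/rowP => k; case: (blockP k) => [l' -> _|ck].
  by rewrite patchrow_bvar !mxE /bvar (inj_eq enum_val_inj).
rewrite patchrow_out// !mxE eqxx; case: eqP => //= kl.
by rewrite kl bvar_block eqxx in ck.
Qed.

Lemma patchrow0 : patchrow (c := c) (j := j) 0 0 = 0 :> 'rV[R]_n.
Proof.
apply/rowP => k; case: (blockP k) => [l -> _|ck].
  by rewrite patchrow_bvar !mxE.
by rewrite patchrow_out.
Qed.

End Rows.

Lemma sum_blocks (R : realType) (n p : nat) (c : 'I_n -> 'I_p)
    (F : 'I_n -> R) :
  \sum_j \sum_(l < bsize c j) F (bvar l) = \sum_k F k.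
Proof.
rewrite (partition_big c xpredT)//=; apply: eq_bigr => j _.
by rewrite -(big_enum_val F).
Qed.

Section Blocks.
Context {R : realType} {n m p : nat} (d : decomposition n m p).
Implicit Types (z : 'rV[R]_n * 'rV[R]_m) (g : 'rV[R]_n * 'rV[R]_m -> R).

Lemma block_patch j z (w : bspace d j) : block d j (Defs.patch z w) = w.
Proof. by case: w => w1 w2; rewrite /block /= !subrow_patchrow. Qed.

Lemma block_patch_neq j j' z (w : bspace d j) :
  j' != j -> block d j' (Defs.patch z w) = block d j' z.
Proof. by move=> jj'; rewrite /block /= !subrow_patchrow_neq. Qed.

Lemma blockB j z z' : block d j (z - z') =
  ((block d j z).1 - (block d j z').1, (block d j z).2 - (block d j z').2).
Proof. by congr (_, _); apply/rowP => l; rewrite !mxE. Qed.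

Lemma patch_line j z
    (v : 'rV[R]_(bsize (xblock d) j) * 'rV[R]_(bsize (yblock d) j)) (t : R) :
  Defs.patch (d := d) (j := j) z (t *: v + block d j z)
  = t *: Defs.patch (d := d) (j := j) 0 v + z.
Proof.
by case: z v => x y [v1 v2]; rewrite /Defs.patch /block /= !patchrow_line.
Qed.

Lemma patch_block j z : Defs.patch z (block d j z) = z.
Proof.
have := patch_line (j := j) z 0 0; rewrite !scale0r !add0r; exact.
Qed.

(** By [patch_line], the difference quotients on both sides are the same function
    of the step. *)
Lemma derive_patch j g z
    (v : 'rV[R]_(bsize (xblock d) j) * 'rV[R]_(bsize (yblock d) j)) :
  'D_v (fun w => g (Defs.patch (d := d) (j := j) z w) : R^o) (block d j z)
  = 'D_(Defs.patch (d := d) (j := j) 0 v) (g : _ -> R^o) z.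
Proof.
rewrite /derive /= patch_block; under eq_fun do rewrite patch_line.
by [].
Qed.

(** Differentiability turns the directional derivative into a linear function of
    the direction, determined by its values on the canonical basis. *)
Lemma derive_partials g z v : differentiable (g : _ -> R^o) z ->
  'D_v (g : _ -> R^o) z = dot (grad g z) v.
Proof.
move=> dg; rewrite deriveE//.
have v_sum : v = \sum_k v.1 0 k *: ('e_k, 0) + \sum_k v.2 0 k *: (0, 'e_k).
  have sum_pairE (I : finType) (F : I -> 'rV[R]_n * 'rV[R]_m) :
      \sum_i F i = (\sum_i (F i).1, \sum_i (F i).2).
    by apply: (big_rec3 (fun u a b => u = (a, b))) => // i a b u _ ->.
  case: v => v1 v2 /=; rewrite !sum_pairE.
  congr (_, _); rewrite /= [LHS]row_sum_delta.
    by rewrite [X in _ + X]big1 ?addr0// => k _; rewrite scaler0.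
  by rewrite [X in X + _]big1 ?add0r// => k _; rewrite scaler0.
rewrite [in LHS]v_sum linearD !linear_sum /dot; congr (_ + _);
  by apply: eq_bigr => k _; rewrite linearZ mxE deriveE// [RHS]mulrC.
Qed.

(** Each partial derivative of g occurs in exactly one block gradient, since every
    variable lies in exactly one block; so blockwise first-order conditions add up
    to one on the whole space. *)
Lemma sum_block_grad g z v :
  \sum_j dot (block_grad d j g z) (block d j v) = dot (grad g z) v.
Proof.
rewrite /dot big_split/=; congr (_ + _).
  rewrite -[RHS](sum_blocks (xblock d)); apply: eq_bigr => j _.
  apply: eq_bigr => l _; rewrite !mxE derive_patch /Defs.patch /=.
  by rewrite patchrow_delta patchrow0.
rewrite -[RHS](sum_blocks (yblock d)); apply: eq_bigr => j _.
apply: eq_bigr => l _; rewrite !mxE derive_patch /Defs.patch /=.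
by rewrite patchrow_delta patchrow0.
Qed.

(** A constraint reading block j takes the same value at the patched point as at
    z', a constraint reading another block the same value as at z. *)
Lemma decomposable_patch_feasible (r : nat)
    (gs : 'I_r -> 'rV[R]_n * 'rV[R]_m -> R) j z z' :
  decomposable d gs -> feasible gs z -> feasible gs z' ->
  block_feasible d j gs z (block d j z').
Proof.
move=> hd fz fz' i; have [j' hj'] := hd i.
have [jj'|jj'] := eqVneq j' j.
  by rewrite (hj' _ z') ?fz'// jj' block_patch.
by rewrite (hj' _ z) ?fz// block_patch_neq.
Qed.

End Blocks.

Theorem theorem4p4 (R : realType) (n m p r : nat)
  (hp : (2 <= p <= minn n m)%N)
  (f : 'rV[R]_n -> R) (g : 'rV[R]_n * 'rV[R]_m -> R)
  (gs : 'I_r -> 'rV[R]_n * 'rV[R]_m -> R)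
  (hCN : CN_form f g gs)
  (d : decomposition n m p) (hd : decomposable d gs)
  (xs : 'rV[R]_n) (ys : 'rV[R]_m) (hs : CN_points f g gs (xs, ys))
  (hK : forall j : 'I_p,
    block_feasible d j gs (xs, ys) `&` descent_cone d j g (xs, ys)
      = set0) :
  CNP_optimal g gs (xs, ys) /\ CNO_optimal f xs.
Proof.
have [feas_s fs_eq] := hs.
have gdiff : differentiable (g : _ -> R^o) (xs, ys).
  by have [] := CN_obj_diff hCN.
have g_min z : feasible gs z -> g (xs, ys) <= g z.
  move=> fz; rewrite -subr_ge0.
  have := convex_derive_le (CN_obj_convex hCN)
    (diff_derivable (v := z - (xs, ys)) gdiff).
  apply: le_trans.
  rewrite derive_partials// -(sum_block_grad d); apply: sumr_ge0 => j _.
  rewrite leNgt; apply/negP => hlt.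
  have : (block_feasible d j gs (xs, ys) `&` descent_cone d j g (xs, ys))
      (block d j z).
    split; first exact: decomposable_patch_feasible.
    by move: hlt; rewrite blockB.
  by rewrite hK.
split; first by split.
split=> // x _; have [y [-> [fxy _]]] := CN_min hCN x.
by rewrite [f xs]fs_eq; apply: g_min.
Qed.
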